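(* Let $M$ be a hemi-slant submanifold of a cosymplectic manifold $N$, with $TM = D^{\theta}\oplus D^{\perp}\oplus\langle\xi\rangle$. Then the distribution $D^{\theta}\oplus D^{\perp}$ is integrable if and only if $$g([X,Y],\xi)=0$$ for all $X,Y\in D^{\theta}\oplus D^{\perp}$.
   Context: An almost contact metric manifold is a $(2m+1)$-dimensional manifold $N$ with structure $(\phi,\xi,\eta,g)$, where $\phi$ is a $(1,1)$-tensor field, $\xi$ a vector field, $\eta$ a one-form and $g$ a Riemannian metric, satisfying $\phi^2=-I+\eta\otimes\xi$, $\eta(\xi)=1$, $g(\phi X,\phi Y)=g(X,Y)-\eta(X)\eta(Y)$; consequently $\phi\xi=0$, $\eta(\phi X)=0$, $\eta(X)=g(X,\xi)$, $g(\phi X,Y)+g(X,\phi Y)=0$. A normal almost contact metric manifold $N$ with Levi-Civita connection $\overline{\nabla}$ is called cosymplectic if $\overline{\nabla}_X\phi=0$ and $\overline{\nabla}_X\xi=0$ for all $X$. $M$ is a submanifold of $N$ with $\xi$ tangent to $M$, equipped with the induced metric. $M$ is a hemi-slant submanifold if there are two orthogonal distributions $D^{\theta}$, $D^{\perp}$ on $M$ such that (i) $TM=D^{\theta}\oplus D^{\perp}\oplus\langle\xi\rangle$ (orthogonal sum), where $\langle\xi\rangle$ is the distribution spanned by $\xi$; (ii) $D^{\theta}$ is a slant distribution with slant angle $\theta\neq\frac{\pi}{2}$, i.e. for every $x\in M$ and every nonzero $X\in D^{\theta}_x$ the angle in $[0,\frac{\pi}{2}]$ between $\phi X$ and $T_xM$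 equals the constant $\theta$; (iii) $D^{\perp}$ is totally real, i.e. $\phi D^{\perp}\subseteq T^{\perp}M$. *)

(* Defs.v *)
From HB Require Import structures.
From mathcomp Require Import all_boot all_order all_algebra.
From mathcomp Require Import all_classical reals.
From mathcomp Require Import ring.
From mathcomp Require Import topology normedtype landau derive trigo.
Import Order.TTheory GRing.Theory Num.Theory numFieldNormedType.Exports.

Set Implicit Arguments.
Unset Strict Implicit.
Unset Printing Implicit Defensive.

Local Open Scope classical_set_scope.
Local Open Scope ring_scope.

(* C^k on an open subset U of a finite-dimensional space: Frechet differentiable
   with all directional derivatives of class C^(k-1). *)
Fixpoint Ck (R : realType) (V W : normedModType R) (k : nat) (U : set V)
    (f : V -> W) : Prop :=
  if k is k'.+1 then
    (forall x, U x -> differentiable f x) /\ (forall v, Ck k' U ('D_v f))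
  else forall x, U x -> {for x, continuous f}.

Definition smooth_on (R : realType) (V W : normedModType R) (U : set V)
  (f : V -> W) : Prop := forall k, Ck k U f.

Section CkTheory.
Context {R : realType}.
Implicit Types V W : normedModType R.

Lemma near_eq_differentiable V W (f g : V -> W) (x : V) :
  (\near x, f x = g x) -> differentiable f x -> differentiable g x.
Proof.
move=> fg /diff_locallyP[cdf dfx].
have gx : g \o shift x = cst (g x) + 'd f x +o_ 0 id.
  apply/eqaddoP => e e0.
  move/eqaddoP : dfx => /(_ _ e0).
  have : \forall y \near 0, f (y + x) = g (y + x).
    by move: fg; rewrite (near_shift 0 x) subr0.
  move=> fgx; apply: filterS2 fgx => y fgy.
  by rewrite /= !fctE /= fgy (nbhs_singleton fg).
by apply/diff_locallyP; rewrite (diff_unique cdf gx).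
Qed.

Lemma Ck_continuous V W k U (f : V -> W) x :
  Ck k U f -> U x -> {for x, continuous f}.
Proof.
by case: k => [|k] /=; [exact|move=> [df _] /df /differentiable_continuous].
Qed.

Lemma Ck_ext V W k U (f g : V -> W) : open U -> (forall x, U x -> f x = g x) ->
  Ck k U f -> Ck k U g.
Proof.
have nfg (h1 h2 : V -> W) : open U -> (forall x, U x -> h1 x = h2 x) ->
    forall x, U x -> \forall y \near x, h1 y = h2 y.
  by move=> oU h12 x Ux; apply: filterS (open_nbhs_nbhs (conj oU Ux)).
move=> oU; elim: k f g => [|k IH] f g fg /=.
  move=> cf x Ux; have := cf x Ux; rewrite /prop_for /continuous_at -(fg _ Ux).
  by apply: cvg_trans; apply: near_eq_cvg; exact: nfg.
move=> [df Df]; split=> [x Ux|v].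
  by apply: near_eq_differentiable (df _ Ux); exact: nfg.
by apply: IH (Df v) => x Ux; apply: near_eq_derive; exact: nfg.
Qed.

Lemma Ck_local V W k U (f : V -> W) :
  (forall x, U x -> exists2 A, A x & Ck k A f) -> Ck k U f.
Proof.
elim: k f => [|k IH] f /= H; first by move=> x /H [A Ax]; exact.
split=> [x /H [A Ax [+ _]]|v]; first exact.
by apply: IH => x /H [A Ax [_ +]]; exists A.
Qed.

Lemma Ck_sub V W k A U (f : V -> W) : A `<=` U -> Ck k U f -> Ck k A f.
Proof. by move=> AU CU; apply: Ck_local => x /AU Ux; exists U. Qed.

Lemma CkW V W k U (f : V -> W) : Ck k.+1 U f -> Ck k U f.
Proof.
elim: k f => [|k IH] f.
  by move=> Cf x Ux; exact: Ck_continuous Cf Ux.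
by move=> [df Df]; split=> // v; exact: IH (Df v).
Qed.

Lemma Ck_cst V W k U (a : W) : Ck k U (fun _ : V => a).
Proof.
elim: k a => [|k IH] a /=; first by move=> x _; exact: cst_continuous.
split=> [x _|v]; first exact: differentiable_cst.
rewrite (_ : 'D_v _ = fun=> 0); first exact: IH.
by apply/funext => x; exact: derive_cst.
Qed.

Lemma CkD V W k U (f g : V -> W) : open U ->
  Ck k U f -> Ck k U g -> Ck k U (f + g).
Proof.
move=> oU; elim: k f g => [|k IH] f g /=.
  by move=> cf cg x Ux; apply: continuousD; [exact: cf|exact: cg].
move=> [df Df] [dg Dg]; split=> [x Ux|v].
  by apply: differentiableD; [exact: df|exact: dg].
apply: (Ck_ext oU _ (IH _ _ (Df v) (Dg v))) => x Ux.
by rewrite deriveD//; apply: diff_derivable; [exact: df|exact: dg].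
Qed.

Lemma CkM V k U (f g : V -> R) : open U ->
  Ck k U f -> Ck k U g -> Ck k U (f * g).
Proof.
move=> oU; elim: k f g => [|k IH] f g.
  by move=> cf cg x Ux; apply: continuousM; [exact: cf|exact: cg].
move=> Cf Cg; have [df Df] := Cf; have [dg Dg] := Cg; split=> [x Ux|v].
  by apply: differentiableM; [exact: df|exact: dg].
have /= C := CkD oU (IH _ _ (CkW Cf) (Dg v)) (IH _ _ (CkW Cg) (Df v)).
apply: (Ck_ext oU _ C) => x Ux.
by rewrite deriveM//; apply: diff_derivable; [exact: df|exact: dg].
Qed.

Lemma Ck_sum V W k U n (f : 'I_n -> V -> W) : open U ->
  (forall i, Ck k U (f i)) -> Ck k U (fun x => \sum_(i < n) f i x).
Proof.
move=> oU Cf; rewrite -fct_sumE.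
by elim/big_ind : _ => //; [exact: (Ck_cst (W := W) k U 0)|move=> *; exact: CkD].
Qed.

Lemma Ck_coord V k U n (F : V -> 'rV[R]_n) i : open U ->
  Ck k U F -> Ck k U (fun x => F x ord0 i).
Proof.
move=> oU; elim: k F => [|k IH] F /=.
  move=> cF x Ux; apply: (@continuous_comp _ _ _ F (fun N : 'rV[R]_n => N ord0 i)).
    exact: cF.
  exact: coord_continuous.
move=> [dF DF]; split=> [x Ux|v].
  apply: (@differentiable_comp _ _ _ _ F (fun N : 'rV[R]_n => N ord0 i : R)).
    exact: dF.
  exact: differentiable_coord.
apply: (Ck_ext oU _ (IH _ (DF v))) => x Ux.
by rewrite derive_mx ?mxE//; apply: diff_derivable; exact: dF.
Qed.

Lemma Ck_comp V n k U A (F : V -> 'rV[R]_n) (f : 'rV[R]_n -> R) :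
  open U -> (forall x, U x -> A (F x)) ->
  Ck k U F -> Ck k A f -> Ck k U (f \o F).
Proof.
move=> oU FA; elim: k f => [|k IH] f.
  by move=> cF cf x Ux; apply: continuous_comp; [exact: cF|apply: cf; exact: FA].
move=> CF [df Df]; have [dF DF] := CF; split=> [x Ux|v].
  by apply: differentiable_comp; [exact: dF|apply: df; exact: FA].
apply: (@Ck_ext _ _ _ _ (fun x => \sum_(i < n)
    (('D_(delta_mx ord0 i) f \o F) * (fun x => 'D_v F x ord0 i)) x)) => //; last first.
  apply: Ck_sum => // i; apply: CkM => //; first exact: IH (CkW CF) (Df _).
  exact: (Ck_coord i oU (DF v)).
move=> x Ux; have dFx := dF _ Ux; have dfx := df _ (FA _ Ux).
rewrite deriveE; last exact: differentiable_comp.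
rewrite diff_comp//= -(deriveE _ dFx).
rewrite [LHS](eq_bigr (fun i => 'd f (F x) ('D_v F x ord0 i *: delta_mx ord0 i))).
  by rewrite -linear_sum -row_sum_delta.
by move=> i _; rewrite linearZ -deriveE//; exact: mulrC.
Qed.

End CkTheory.

(* cmap and cinv are total functions, constrained only on cdom and on its image:
   a homeomorphism from the open set cdom onto an open subset of R^n. *)
Record chart (R : realType) (n : nat) (T : topologicalType) := Chart {
  cdom : set T;
  cmap : T -> 'rV[R]_n;
  cinv : 'rV[R]_n -> T;
  open_cdom : open cdom;
  open_cimg : open (cmap @` cdom);
  cmapK : forall x, cdom x -> cinv (cmap x) = x;
  cmap_continuous : forall x, cdom x -> {for x, continuous cmap};
  cinv_continuous : forall y, (cmap @` cdom) y -> {for y, continuous cinv} }.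

Definition cimg (R : realType) (n : nat) (T : topologicalType)
  (c : chart R n T) : set 'rV[R]_n := cmap c @` cdom c.

Record manifold (R : realType) (n : nat) := Manifold {
  mspace :> topologicalType;
  atlas : set (chart R n mspace);
  manifold_hausdorff : hausdorff_space mspace;
  manifold_second_countable : @second_countable mspace;
  atlas_cover : forall x : mspace, exists2 c, atlas c & cdom c x;
  atlas_compatible : forall c c', atlas c -> atlas c' ->
    smooth_on (cmap c @` (cdom c `&` cdom c')) (cmap c' \o cinv c) }.

Definition smooth_fun (R : realType) (n : nat) (M : manifold R n)
  (f : M -> R) : Prop :=
  forall c, atlas c -> smooth_on (cimg c) (f \o cinv c).

Record smooth_map (R : realType) (d n : nat) (M : manifold R d)
    (N : manifold R n) := SmoothMap {
  smap :> M -> N;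
  smap_continuous : continuous smap;
  smapP : forall c c', atlas c -> atlas c' ->
    smooth_on (cmap c @` (cdom c `&` smap @^-1` cdom c'))
      (cmap c' \o smap \o cinv c) }.

Record Cinf (R : realType) (n : nat) (M : manifold R n) := MkCinf {
  cfun :> M -> R;
  cfunP : `[< smooth_fun cfun >] }.

Section CinfTheory.
Context {R : realType} {n : nat} (M : manifold R n).
Implicit Types f g : M -> R.

Lemma smooth_fun_cst (a : R) : smooth_fun (fun _ : M => a).
Proof. by move=> c Ac k; exact: Ck_cst. Qed.

Lemma smooth_funD f g : smooth_fun f -> smooth_fun g -> smooth_fun (f + g).
Proof.
by move=> sf sg c Ac k; apply: CkD; [exact: open_cimg|exact: sf|exact: sg].
Qed.

Lemma smooth_funM f g : smooth_fun f -> smooth_fun g -> smooth_fun (f * g).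
Proof.
by move=> sf sg c Ac k; apply: CkM; [exact: open_cimg|exact: sf|exact: sg].
Qed.

Lemma smooth_funZ a f : smooth_fun f -> smooth_fun (fun x => a * f x).
Proof. by apply: smooth_funM; exact: smooth_fun_cst. Qed.

Lemma smooth_funB f g : smooth_fun f -> smooth_fun g -> smooth_fun (f - g).
Proof.
move=> sf sg; have := smooth_funD sf (smooth_funZ (-1) sg).
by congr smooth_fun; apply/funext => x; rewrite /= !fctE /= mulN1r.
Qed.

Definition smooth_pred : {pred M -> R} := fun f => `[< smooth_fun f >].

HB.instance Definition _ := [isSub of Cinf M for @cfun R n M].
HB.instance Definition _ := [Choice of Cinf M by <:].

Lemma smooth_fun_subring : subring_closed smooth_pred.
Proof.
split; first by apply/asboolP; exact: smooth_fun_cst.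
  by move=> f g /asboolP sf /asboolP sg; apply/asboolP; exact: smooth_funB.
by move=> f g /asboolP sf /asboolP sg; apply/asboolP; exact: smooth_funM.
Qed.

HB.instance Definition _ :=
  GRing.SubChoice_isSubComPzRing.Build _ _ (Cinf M) smooth_fun_subring.

Lemma Cinf_smooth (f : Cinf M) : smooth_fun f.
Proof. by apply/asboolP; exact: cfunP. Qed.

Definition mkCinf f (sf : smooth_fun f) : Cinf M := MkCinf (asboolT sf).

Lemma CinfP (f g : Cinf M) : f =1 g -> f = g.
Proof. by move=> fg; apply: val_inj; apply/funext. Qed.

Definition Cinf_scale (a : R) (f : Cinf M) : Cinf M :=
  mkCinf (smooth_funZ a (Cinf_smooth f)).

Let scaleA a b (f : Cinf M) : Cinf_scale a (Cinf_scale b f) = Cinf_scale (a * b) f.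
Proof. by apply: CinfP => x /=; rewrite mulrA. Qed.
Let scale1 : left_id 1 Cinf_scale.
Proof. by move=> f; apply: CinfP => x /=; rewrite mul1r. Qed.
Let scaleDr : right_distributive Cinf_scale +%R.
Proof. by move=> a f g; apply: CinfP => x /=; rewrite !fctE mulrDr. Qed.
Let scaleDl (f : Cinf M) : {morph Cinf_scale^~ f : a b / a + b}.
Proof. by move=> a b; apply: CinfP => x /=; rewrite !fctE mulrDl. Qed.

HB.instance Definition _ :=
  GRing.Zmodule_isLmodule.Build R (Cinf M) scaleA scale1 scaleDr scaleDl.

End CinfTheory.

(* Tangent vectors at x are the derivations at x of the algebra of smooth
   functions. *)
Definition derivation_at (R : realType) (n : nat) (M : manifold R n) (x : M)
    (v : Cinf M -> R) : Prop :=
  (forall (a : R) (f g : Cinf M), v (a *: f + g) = a * v f + v g) /\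
  (forall f g : Cinf M, v (f * g) = v f * g x + f x * v g).

Record tangent (R : realType) (n : nat) (M : manifold R n) (x : M) := MkTangent {
  tfun :> Cinf M -> R^o;
  tfunP : `[< derivation_at x tfun >] }.

Section TangentTheory.
Context {R : realType} {n : nat} (M : manifold R n) (x : M).

Definition derivation_pred : {pred Cinf M -> R^o} :=
  fun v => `[< derivation_at x v >].

HB.instance Definition _ := [isSub of tangent x for @tfun R n M x].
HB.instance Definition _ := [Choice of tangent x by <:].

Lemma derivation_at_subsemimod : subsemimod_closed derivation_pred.
Proof.
split; first split.
- apply/asboolP; split=> *; rewrite ?fctE /=; first by rewrite mulr0 addr0.
  by rewrite mul0r mulr0 addr0.
- move=> v w /asboolP[v1 v2] /asboolP[w1 w2]; apply/asboolP; split=> [a f g|f g].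
    by rewrite !fctE v1 w1 mulrDr addrACA.
  by rewrite !fctE v2 w2 mulrDl mulrDr addrACA.
- move=> b v /asboolP[v1 v2]; apply/asboolP; split=> [a f g|f g].
    by rewrite !fctE v1 scalerDr /GRing.scale /= mulrCA.
  by rewrite !fctE v2 scalerDr /GRing.scale /= mulrA mulrCA.
Qed.

HB.instance Definition _ :=
  GRing.SubChoice_isSubLmodule.Build R _ _ (tangent x) derivation_at_subsemimod.

Lemma tangent_derivation (v : tangent x) : derivation_at x v.
Proof. by apply/asboolP; exact: tfunP. Qed.

Definition mkTangent (v : Cinf M -> R) (dv : derivation_at x v) : tangent x :=
  MkTangent (asboolT dv).

End TangentTheory.

Section Pullback.
Context {R : realType} {d n : nat} {M : manifold R d} {N : manifold R n}.
Variable F : smooth_map M N.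

Lemma smooth_fun_pullback (f : Cinf N) : smooth_fun (f \o F).
Proof.
move=> c Ac k; apply: Ck_local => _ [x cx <-].
have [c' Ac' c'x] := atlas_cover (F x).
exists (cmap c @` (cdom c `&` F @^-1` cdom c')); first by exists x.
set U := cmap c @` _.
have UE : U = cimg c `&` (F \o cinv c) @^-1` cdom c'.
  apply/seteqP; split=> [_ [y [cy c'y] <-]|_ [[y cy <-] /=]].
    by split; [exists y|rewrite /= cmapK].
  by rewrite cmapK // => c'y; exists y.
have oU : open U.
  rewrite openE UE => y [cy c'y].
  have nc : nbhs y (cimg c) by apply: open_nbhs_nbhs; split=> //; exact: open_cimg.
  apply: (filterI nc).
  have ccy : {for y, continuous (F \o cinv c)}.
    apply: continuous_comp; first exact: cinv_continuous.
    exact: smap_continuous.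
  by apply: ccy; exact: (open_nbhs_nbhs (conj (open_cdom c') c'y)).
apply: (@Ck_ext _ _ _ _ _ ((f \o cinv c') \o (cmap c' \o F \o cinv c))) => //.
  move=> _ [y [cy c'y] <-] /=.
  by rewrite (cmapK cy) (cmapK c'y).
apply: (@Ck_comp _ _ _ _ _ (cimg c')) => //.
- by move=> _ [y [cy c'y] <-] /=; exists (F y) => //; rewrite cmapK.
- exact: smapP.
- exact: Cinf_smooth.
Qed.

Definition pullback (f : Cinf N) : Cinf M := mkCinf (smooth_fun_pullback f).

Lemma push_derivation (x : M) (v : tangent x) :
  derivation_at (F x) (fun f => v (pullback f)).
Proof.
have [v1 v2] := tangent_derivation v; split=> [a f g|f g].
  by rewrite -v1; congr (v _); exact: CinfP.
by rewrite -[f (F x)]/(pullback f x) -[g (F x)]/(pullback g x) -v2;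
  congr (v _); exact: CinfP.
Qed.

Definition push (x : M) (v : tangent x) : tangent (F x) :=
  mkTangent (push_derivation v).

End Pullback.

(* A section of the tangent bundle is smooth when it maps smooth functions to
   smooth functions. *)
Record vfield (R : realType) (n : nat) (M : manifold R n) := VField {
  vf :> forall x : M, tangent x;
  vfP : forall f : Cinf M, smooth_fun (fun x => vf x f) }.

Section VFieldOps.
Context {R : realType} {n : nat} {M : manifold R n}.
Implicit Types X Y : vfield M.

Definition vapp X (f : Cinf M) : Cinf M := mkCinf (vfP X f).

Lemma vadd_smooth X Y (f : Cinf M) : smooth_fun (fun x => (X x + Y x) f).
Proof. exact: smooth_funD (vfP X f) (vfP Y f). Qed.

Definition vadd X Y : vfield M := VField (vadd_smooth X Y).

Lemma vscale_smooth (h : Cinf M) X (f : Cinf M) :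
  smooth_fun (fun x => (h x *: X x) f).
Proof. exact: smooth_funM (Cinf_smooth h) (vfP X f). Qed.

Definition vscale (h : Cinf M) X : vfield M := VField (vscale_smooth h X).

Lemma bracket_derivation X Y (x : M) :
  derivation_at x (fun f => X x (vapp Y f) - Y x (vapp X f)).
Proof.
have [X1 X2] := tangent_derivation (X x).
have [Y1 Y2] := tangent_derivation (Y x).
have lin Z a (f g : Cinf M) : vapp Z (a *: f + g) = a *: vapp Z f + vapp Z g.
  by apply: CinfP => y /=; have [-> _] := tangent_derivation (Z y).
have lei Z (f g : Cinf M) : vapp Z (f * g) = vapp Z f * g + f * vapp Z g.
  by apply: CinfP => y /=; have [_ ->] := tangent_derivation (Z y).
have add (v : tangent x) (f g : Cinf M) : v (f + g) = v f + v g.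
  by have [v1 _] := tangent_derivation v; have := v1 1 f g; rewrite scale1r mul1r.
split=> [a f g|f g].
  by rewrite !lin X1 Y1 mulrBr opprD addrACA.
rewrite !lei !add !X2 !Y2 /= mulrBl mulrBr.
set a := X x (vapp Y f); set b := X x (vapp Y g).
set p := Y x (vapp X f); set q := Y x (vapp X g).
rewrite !opprD !addrA; ring.
Qed.

Lemma bracket_smooth X Y (f : Cinf M) :
  smooth_fun (fun x => mkTangent (bracket_derivation X Y x) f).
Proof. exact: smooth_funB (vfP X (vapp Y f)) (vfP Y (vapp X f)). Qed.

Definition bracket X Y : vfield M := VField (bracket_smooth X Y).

End VFieldOps.

Record riemannian (R : realType) (n : nat) (M : manifold R n) := Riemannian {
  metric :> forall x : M, tangent x -> tangent x -> R;
  metric_linear : forall (x : M) (a : R) (u v w : tangent x),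
    metric (a *: u + v) w = a * metric u w + metric v w;
  metric_sym : forall (x : M) (u v : tangent x), metric u v = metric v u;
  metric_pos : forall (x : M) (u : tangent x), u != 0 -> 0 < metric u u;
  metric_smooth : forall X Y : vfield M,
    smooth_fun (fun x => metric (X x) (Y x)) }.

Definition metric_fun (R : realType) (n : nat) (M : manifold R n)
  (g : riemannian M) (X Y : vfield M) : Cinf M := mkCinf (metric_smooth g X Y).

Definition connection (R : realType) (n : nat) (M : manifold R n)
    (nabla : vfield M -> vfield M -> vfield M) : Prop :=
  [/\ forall (f : Cinf M) (X X' Y : vfield M) (x : M),
        nabla (vadd (vscale f X) X') Y x = f x *: nabla X Y x + nabla X' Y x,
      forall (X Y Y' : vfield M) (x : M),
        nabla X (vadd Y Y') x = nabla X Y x + nabla X Y' x &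
      forall (f : Cinf M) (X Y : vfield M) (x : M),
        nabla X (vscale f Y) x = X x f *: Y x + f x *: nabla X Y x].

Definition levi_civita (R : realType) (n : nat) (M : manifold R n)
    (g : riemannian M) (nabla : vfield M -> vfield M -> vfield M) : Prop :=
  [/\ connection nabla,
      forall (X Y Z : vfield M) (x : M),
        Z x (metric_fun g X Y) =
          g x (nabla Z X x) (Y x) + g x (X x) (nabla Z Y x) &
      forall (X Y : vfield M) (x : M),
        nabla X Y x - nabla Y X x = bracket X Y x].

Record almost_contact_metric (R : realType) (m : nat)
    (N : manifold R (2 * m + 1)) := AlmostContactMetric {
  acm_phi : forall x : N, {linear tangent x -> tangent x};
  acm_phi_smooth : forall (X : vfield N) (f : Cinf N),
    smooth_fun (fun x => acm_phi x (X x) f);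
  acm_xi : vfield N;
  acm_eta : forall x : N, {scalar tangent x};
  acm_eta_smooth : forall X : vfield N, smooth_fun (fun x => acm_eta x (X x));
  acm_g : riemannian N;
  acm_phi2 : forall (x : N) (u : tangent x),
    acm_phi x (acm_phi x u) = - u + acm_eta x u *: acm_xi x;
  acm_eta_xi : forall x : N, acm_eta x (acm_xi x) = 1;
  acm_compat : forall (x : N) (u v : tangent x),
    acm_g x (acm_phi x u) (acm_phi x v) = acm_g x u v - acm_eta x u * acm_eta x v }.

Section AlmostContact.
Context {R : realType} {m : nat} {N : manifold R (2 * m + 1)}.
Variable S : almost_contact_metric N.

Definition phi_field (X : vfield N) : vfield N := VField (acm_phi_smooth S X).

Definition eta_fun (X : vfield N) : Cinf N := mkCinf (acm_eta_smooth S X).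

(* The Nijenhuis torsion [phi, phi](X, Y). *)
Definition nijenhuis (X Y : vfield N) (x : N) : tangent x :=
  acm_phi S x (acm_phi S x (bracket X Y x))
  + bracket (phi_field X) (phi_field Y) x
  - acm_phi S x (bracket (phi_field X) Y x)
  - acm_phi S x (bracket X (phi_field Y) x).

(* X(eta Y) - Y(eta X) - eta([X, Y]), which is 2 d eta (X, Y) when the exterior
   derivative carries the factor 1/2 usual in contact geometry. *)
Definition two_deta (X Y : vfield N) (x : N) : R :=
  X x (eta_fun Y) - Y x (eta_fun X) - acm_eta S x (bracket X Y x).

Definition normal_acm : Prop := forall (X Y : vfield N) (x : N),
  nijenhuis X Y x + two_deta X Y x *: acm_xi S x = 0.

Definition cosymplectic (nabla : vfield N -> vfield N -> vfield N) : Prop :=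
  [/\ normal_acm,
      forall (X Y : vfield N) (x : N),
        nabla X (phi_field Y) x - acm_phi S x (nabla X Y x) = 0 &
      forall (X : vfield N) (x : N), nabla X (acm_xi S) x = 0].

End AlmostContact.

(* Immersed submanifold; M carries the metric induced by push iota. *)
Definition submanifold (R : realType) (d n : nat) (M : manifold R d)
    (N : manifold R n) (iota : smooth_map M N) : Prop :=
  injective iota /\ forall x : M, injective (@push R d n M N iota x).

Section Distributions.
Context {R : realType} {d : nat} {M : manifold R d}.
Implicit Types D E : forall x : M, set (tangent x).

(* A smooth subbundle of TM of constant rank r. Local frames are taken to be
   restrictions of global vector fields: by bump functions, any local frame
   agrees near x with such a restriction. *)
Definition distribution D : Prop :=
  exists r : nat, forall x : M, exists (U : set M) (X : 'I_r -> vfield M),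
    [/\ open U, U x & forall y : M, U y ->
      D y = [set v | exists a : 'I_r -> R, v = \sum_(i < r) a i *: X i y] /\
      (forall a : 'I_r -> R, \sum_(i < r) a i *: X i y = 0 ->
         forall i, a i = 0)].

Definition dsum D E : forall x : M, set (tangent x) :=
  fun x => [set u + v | u in D x & v in E x].

Definition section_of D (X : vfield M) : Prop := forall x : M, D x (X x).

(* Integrability is closure under the Lie bracket of sections, as in Warner,
   Foundations of Differentiable Manifolds and Lie Groups, 1.56. *)
Definition integrable_distribution D : Prop :=
  forall X Y : vfield M,
    section_of D X -> section_of D Y -> section_of D (bracket X Y).

End Distributions.
Arguments dsum {R d M} D E x _.

Section HemiSlant.
Context {R : realType} {d m : nat} {M : manifold R d}
  {N : manifold R (2 * m + 1)}.
Variables (S : almost_contact_metric N) (iota : smooth_map M N).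
Implicit Types D E : forall x : M, set (tangent x).

Definition xi_tangent : Prop := forall x : M,
  exists z : tangent x, push iota z = acm_xi S (iota x).

Definition xi_line : forall x : M, set (tangent x) := fun x =>
  [set z | exists a : R, push iota z = a *: acm_xi S (iota x)].
Arguments xi_line x _ : clear implicits.

Definition orthogonal_distributions D E : Prop :=
  forall (x : M) (u v : tangent x), D x u -> E x v ->
    acm_g S (iota x) (push iota u) (push iota v) = 0.

Definition tnorm (y : N) (u : tangent y) : R := Num.sqrt (acm_g S y u u).

(* angle_with_TM w theta: theta in [0, pi/2] is the angle between the nonzero
   vector w of T_(iota x) N and the subspace T_x M, namely the angle between w
   and its orthogonal projection onto T_x M (pi/2 if that projection is 0). *)
Definition angle_with_TM (x : M) (w : tangent (iota x)) (theta : R) : Prop :=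
  exists2 p : tangent x,
    (forall u : tangent x, acm_g S (iota x) (w - push iota p) (push iota u) = 0) &
    theta = acos (tnorm (push iota p) / tnorm w).

Definition slant D (theta : R) : Prop :=
  forall (x : M) (u : tangent x), D x u -> u != 0 ->
    angle_with_TM (acm_phi S (iota x) (push iota u)) theta.

Definition totally_real D : Prop :=
  forall (x : M) (u v : tangent x), D x u ->
    acm_g S (iota x) (acm_phi S (iota x) (push iota u)) (push iota v) = 0.

(* The sum in hs_sum is direct because its summands are mutually orthogonal. *)
Record hemi_slant (theta : R) (Dtheta Dperp : forall x : M, set (tangent x)) :
    Prop := HemiSlant {
  hs_Dtheta : distribution Dtheta;
  hs_Dperp : distribution Dperp;
  hs_orth : orthogonal_distributions Dtheta Dperp;
  hs_orth_xi : orthogonal_distributions (dsum Dtheta Dperp) xi_line;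
  hs_sum : forall x : M, dsum (dsum Dtheta Dperp) xi_line x = setT;
  hs_theta_ge0 : 0 <= theta;
  hs_theta_lt : theta <= pi / 2;
  hs_theta_neq : theta != pi / 2;
  hs_slant : slant Dtheta theta;
  hs_totally_real : totally_real Dperp }.

End HemiSlant.

(* Main.v *)
(* Write a tangent vector w of M as u + a xi with u in Dtheta + Dperp.
   Orthogonality gives g(w, xi) = a g(xi, xi), so Dtheta + Dperp is exactly the
   orthogonal complement of xi in TM. Applied to w = [X, Y], this is the
   equivalence. *)

Require Import Defs.
From mathcomp Require Import all_boot all_order all_algebra.
From mathcomp Require Import all_classical reals.
From mathcomp Require Import topology normedtype.

Import GRing.Theory Num.Theory numFieldNormedType.Exports.

Local Open Scope classical_set_scope.
Local Open Scope ring_scope.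

Set Implicit Arguments.
Unset Strict Implicit.

(** Tangent vectors are functions on [Cinf], and both sides act identically by conversion, so
    injectivity of the coercion suffices. *)
Lemma pushD (R : realType) (d n : nat) (M : manifold R d) (N : manifold R n)
  (F : smooth_map M N) (x : M) (u v : tangent x) :
  push F (u + v) = push F u + push F v.
Proof. exact: val_inj. Qed.

Lemma push0 (R : realType) (d n : nat) (M : manifold R d) (N : manifold R n)
  (F : smooth_map M N) (x : M) : push F (0 : tangent x) = 0.
Proof. exact: val_inj. Qed.

Lemma metricD (R : realType) (n : nat) (M : manifold R n) (g : riemannian M)
  (x : M) (u v w : tangent x) : g x (u + v) w = g x u w + g x v w.
Proof. by rewrite -{1}[u]scale1r metric_linear mul1r. Qed.

Lemma metric0 (R : realType) (n : nat) (M : manifold R n) (g : riemannian M)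
  (x : M) (w : tangent x) : g x 0 w = 0.
Proof. by apply: (addIr (g x 0 w)); rewrite -metricD !add0r. Qed.

Lemma metricZ (R : realType) (n : nat) (M : manifold R n) (g : riemannian M)
  (x : M) (a : R) (u w : tangent x) : g x (a *: u) w = a * g x u w.
Proof. by rewrite -[a *: u]addr0 metric_linear metric0 addr0. Qed.

(** The linear form [acm_eta] takes the value 1 on this vector. *)
Lemma acm_xi_neq0 (R : realType) (m : nat) (N : manifold R (2 * m + 1))
  (S : almost_contact_metric N) (y : N) : acm_xi S y != 0.
Proof.
apply/eqP => xi0; have := acm_eta_xi S y.
by rewrite xi0 linear0 => /eqP; rewrite eq_sym oner_eq0.
Qed.

Lemma hemi_slant_memP (R : realType) (m d : nat)
  (N : manifold R (2 * m + 1)) (S : almost_contact_metric N)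
  (M : manifold R d) (iota : smooth_map M N)
  (M_submanifold : submanifold iota) (M_xi_tangent : xi_tangent S iota)
  (theta : R) (Dtheta Dperp : forall x : M, set (tangent x))
  (M_hemi_slant : hemi_slant S iota theta Dtheta Dperp)
  (x : M) (w : tangent x) :
  dsum Dtheta Dperp x w <->
  acm_g S (iota x) (push iota w) (acm_xi S (iota x)) = 0.
Proof.
have [z z_xi] := M_xi_tangent x.
have orth_xi u : dsum Dtheta Dperp x u ->
    acm_g S (iota x) (push iota u) (acm_xi S (iota x)) = 0.
  (* [hs_orth_xi] pairs vectors tangent to [M], so xi is replaced by the image of [z], which lies in
     [xi_line] with coefficient 1. *)
  move=> Du; rewrite -z_xi; apply: (hs_orth_xi M_hemi_slant Du).
  by exists 1; rewrite scale1r.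
split=> [|w_xi]; first exact: orth_xi.
have : dsum (dsum Dtheta Dperp) (xi_line S iota) x w.
  by rewrite (hs_sum M_hemi_slant).
move=> [u Du [v [a v_xi] uvw]]; move: w_xi.
rewrite -uvw pushD metricD (orth_xi u Du) add0r v_xi metricZ => /eqP.
(* What is left of the hypothesis is a g(xi, xi) = 0, and g(xi, xi) > 0 because xi is nonzero. *)
rewrite mulf_eq0 (negPf (lt0r_neq0 (metric_pos _ (acm_xi_neq0 S _)))) orbF.
move=> /eqP a0; suff -> : v = 0 by rewrite addr0.
(* Only the image of [v] is known to vanish; injectivity of the differential of [iota] brings this
   back to [v]. *)
by apply: (M_submanifold.2 x); rewrite v_xi a0 scale0r push0.
Qed.

Unset Implicit Arguments.
Set Strict Implicit.

Theorem theorem3p6 (R : realType) (m d : nat)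
  (N : manifold R (2 * m + 1)) (S : almost_contact_metric N)
  (nabla : vfield N -> vfield N -> vfield N)
  (nabla_LC : levi_civita (acm_g S) nabla)
  (N_cosymplectic : cosymplectic S nabla)
  (M : manifold R d) (iota : smooth_map M N)
  (M_submanifold : submanifold iota)
  (M_xi_tangent : xi_tangent S iota)
  (theta : R) (Dtheta Dperp : forall x : M, set (tangent x))
  (M_hemi_slant : hemi_slant S iota theta Dtheta Dperp) :
  integrable_distribution (dsum Dtheta Dperp) <->
  (forall X Y : vfield M,
     section_of (dsum Dtheta Dperp) X -> section_of (dsum Dtheta Dperp) Y ->
     forall x : M,
       acm_g S (iota x) (push iota (bracket X Y x)) (acm_xi S (iota x)) = 0).
Proof.
have memP := hemi_slant_memP M_submanifold M_xi_tangent M_hemi_slant.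
(* Unfolded, both sides are pointwise statements on [bracket X Y x] under the same quantifiers, so
   one script serves both directions. *)
by split=> H X Y DX DY x; apply/memP; exact: H.
Qed.
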